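(* Fix numbers $\kappa>0$ and $0<\delta<1$. Then there exists a number $q=q(\kappa,\delta)$ such that the following holds. Let $m,n$ be integers with $n\ge m>q$, and let $R=(r_1,\ldots,r_m)$, $C=(c_1,\ldots,c_n)$ be vectors of positive integers with $\sum_ir_i=\sum_jc_j$, $0<r_i<n$, $0<c_j<m$, such that the polytope $\mathcal{P}(R,C)$ of real $m\times n$ matrices with row sums $R$, column sums $C$ and entries in $[0,1]$ contains a matrix with all entries strictly between $0$ and $1$. Let $Z$ be the maximum entropy matrix, i.e., the unique maximizer on $\mathcal{P}(R,C)$ of $H(X)=\sum_{i,j}\big(x_{ij}\ln\frac1{x_{ij}}+(1-x_{ij})\ln\frac1{1-x_{ij}}\big)$. Let $S\subset\{(i,j):1\le i\le m,\ 1\le j\le n\}$ satisfy $\sigma_S(Z)\ge\delta mn$, and let $\epsilon=\delta\frac{\ln n}{\sqrt m}$. If $\epsilon\le1$, then for $D$ chosen uniformly at random from the set $\Sigma(R,C)$ of $m\times n$ 0-1 matrices with row sums $R$ and column sums $C$, $$\Pr\big\{(1-\epsilon)\sigma_S(Z)\le\sigma_S(D)\le(1+\epsilon)\sigma_S(Z)\big\}\ \ge\ 1-2n^{-\kappa n}.$$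
   Context: For a subset $S$ of index pairs and an $m\times n$ matrix $A=(a_{ij})$, $\sigma_S(A)=\sum_{(i,j)\in S}a_{ij}$. The convention $0\ln\frac10=0$ is used in $H$. *)

(* Defs.v *)
From HB Require Import structures.
From mathcomp Require Import all_boot all_order all_algebra.
From mathcomp Require Import all_classical all_reals all_analysis.

Set Implicit Arguments.
Unset Strict Implicit.
Unset Printing Implicit Defensive.
Import Order.TTheory GRing.Theory Num.Theory.
Local Open Scope classical_set_scope.
Local Open Scope ring_scope.

Definition sigmaS (R : realType) (m n : nat) (S : {set 'I_m * 'I_n})
    (A : 'M[R]_(m, n)) : R :=
  \sum_(p in S) A p.1 p.2.

Definition polytope (R : realType) (m n : nat)
    (r : 'I_m -> nat) (c : 'I_n -> nat) : set 'M[R]_(m, n) :=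
  [set X | [/\ forall i, \sum_j X i j = (r i)%:R,
               forall j, \sum_i X i j = (c j)%:R &
               forall i j, 0 <= X i j <= 1]].

(* At x = 0 the factor x makes x * ln (1 / x) vanish, so the convention
   0 ln (1/0) = 0 holds (and likewise for 1 - x at x = 1). *)
Definition entropy (R : realType) (m n : nat) (X : 'M[R]_(m, n)) : R :=
  \sum_i \sum_j (X i j * ln (1 / X i j) + (1 - X i j) * ln (1 / (1 - X i j))).

(* The maximizer is unique: entropy is strictly concave on [0, 1]^(m x n) and
   the polytope is convex. *)
Definition is_max_entropy (R : realType) (m n : nat)
    (r : 'I_m -> nat) (c : 'I_n -> nat) (Z : 'M[R]_(m, n)) : Prop :=
  polytope r c Z /\ forall X, polytope r c X -> entropy X <= entropy Z.

(* 0-1 matrices are encoded as boolean matrices, which form a finType. *)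
Definition Sigma01 (m n : nat) (r : 'I_m -> nat) (c : 'I_n -> nat) :
    {set 'M[bool]_(m, n)} :=
  [set D : 'M[bool]_(m, n) |
     [forall i, (\sum_j D i j == r i)%N] && [forall j, (\sum_i D i j == c j)%N]].

Definition real_of_01 (R : realType) (m n : nat) (D : 'M[bool]_(m, n)) :
    'M[R]_(m, n) :=
  map_mx (fun b : bool => (b : nat)%:R) D.

(* Probability of E under the uniform distribution on a nonempty A. *)
Definition unif_prob (R : realType) (T : finType) (A : {set T}) (E : pred T) : R :=
  #|[set x in A | E x]|%:R / #|A|%:R.

(* Main.v *)
(** Let [X] have independent Bernoulli([Z i j]) entries.  By maximality of the
    entropy of [Z], every [D] in Sigma(R,C) satisfies P(X = D) >= exp(-H(Z)),
    so a Chernoff bound for [X] bounds the number of bad [D] by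
    2 exp(H(Z) - eps^2 sigma_S(Z) / 8).  It remains to show
    |Sigma(R,C)| >= exp(H(Z) - 2) / (4mn)^(m+n).

    Let N_k(v) be the number of subgraphs with degree vector v in the complete
    bipartite graph K_(m,n) with every edge repeated k times.  If u + u' = 2h
    then N_k(u) N_k(u') <= N_k(h)^2: sorting the pairs (F, G) by intersection T
    and symmetric difference U reduces this to the claim that, in a bipartite
    multigraph W whose degrees are all even, no degree vector is realized by
    more subgraphs than half the degree vector of W.  With x and z the two
    numbers of subgraphs, the same sorting inside W gives, by induction over
    proper subsets U, that x^2 - x <= z^2 - z; and z >= 1 because an even
    bipartite multigraph has a balanced 2-colouring of its edges.  Summing over
    the ways to write 2v = u + u' gives
    N_2k(2v) <= (kmn + 1)^(m+n) N_k(v)^2.  Iterating over k = 2^l bounds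
    N_1(R,C) from below by limits of N_k(kR,kC)^(1/k), which products of
    binomial coefficients 'C(k, A i j) with A close to kZ bound by exp(H(Z)). *)

Require Import Defs.
From HB Require Import structures.
From mathcomp Require Import all_boot all_order all_algebra.
From mathcomp Require Import all_classical all_reals all_analysis.
From mathcomp Require Import fintype finset zify ring lra.
Import Order.TTheory GRing.Theory Num.Theory.

Set Implicit Arguments.
Unset Strict Implicit.
Unset Printing Implicit Defensive.

Local Open Scope nat_scope.

(** * Halving even bipartite multigraphs *)

(** Each class of [key] in [W] has even size, so exchanging positions 2i and 2i+1 in a listing of
    the class pairs its elements off. *)
Lemma exists_pairing (E K : finType) (key : E -> K) (W : {set E}) :
  (forall k, ~~ odd #|[set e in W | key e == k]|) ->
  exists f : E -> E, forall e, e \in W ->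
    [/\ f e \in W, f e != e, f (f e) = e & key (f e) = key e].
Proof.
move=> evenW.
pose s e := enum [set x in W | key x == key e].
pose swap i := if odd i then i.-1 else i.+1.
exists (fun e => nth e (s e) (swap (index e (s e)))) => e eW.
have es : e \in s e by rewrite mem_enum inE eW eqxx.
have ies : index e (s e) < size (s e) by rewrite index_mem.
have ev : ~~ odd (size (s e)) by rewrite -cardE; apply: evenW.
have lt_swap : swap (index e (s e)) < size (s e).
  by rewrite /swap; case: ifP => oi; lia.
set e' := nth e (s e) _.
have e's : e' \in s e by apply: mem_nth.
move: (e's); rewrite mem_enum inE => /andP[e'W /eqP ke'].
have se' : s e' = s e by rewrite /s ke'.
have ie' : index e' (s e') = swap (index e (s e)).
  by rewrite se' index_uniq // enum_uniq.
split=> //.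
- apply/eqP => ee'; have := ie'; rewrite se' {1}ee' /swap.
  by case: ifP => oi; lia.
- rewrite ie' se'; have -> : swap (swap (index e (s e))) = index e (s e).
    rewrite /swap; case: (boolP (odd (index e (s e)))) => oi.
      by rewrite ifF; lia.
    by rewrite ifT; lia.
  by rewrite (set_nth_default e) // nth_index.
Qed.

(** Two perfect matchings of [W] form even cycles, along which colours alternate. The composite [p]
    advances two steps, so a cycle consists of two [p]-orbits, exchanged by [f] and by [g]; the
    colour tells which of the two has the root of smaller rank. *)
Lemma alternating_colouring (E : finType) (W : {set E}) (f g : E -> E) :
  (forall e, e \in W -> [/\ f e \in W, f e != e & f (f e) = e]) ->
  (forall e, e \in W -> [/\ g e \in W, g e != e & g (g e) = e]) ->
  exists chi : pred E, forall e, e \in W ->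
    chi (f e) = ~~ chi e /\ chi (g e) = ~~ chi e.
Proof.
move=> fP gP; pose p e := if e \in W then f (g e) else e.
have pW e : e \in W -> p e \in W.
  by move=> eW; rewrite /p eW; case: (gP e eW) => ? _ _; case: (fP (g e)).
have ipW k e : e \in W -> iter k p e \in W.
  by elim: k => //= k IH eW; apply/pW/IH.
have pinj : injective p.
  move=> x y; rewrite /p; case: ifPn => xW; case: ifPn => yW //.
  - move=> /(congr1 f).
    case: (gP x xW) => gxW _ ggx; case: (gP y yW) => gyW _ ggy.
    case: (fP _ gxW) => _ _ ->; case: (fP _ gyW) => _ _ ->.
    by move/(congr1 g); rewrite ggx ggy.
  - move=> E1; case/negP: yW; rewrite -E1.
    by case: (gP x xW) => ? _ _; case: (fP (g x)).
  - move=> E1; case/negP: xW; rewrite E1.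
    by case: (gP y yW) => ? _ _; case: (fP (g y)).
have psym : connect_sym (frel p) by apply: fconnect_sym.
(* If [f e] is [k.+2] steps of [p] from [e], then [g e = f (p e)] is [k] steps from [p e]; the
   descent ends at a fixed point of [f] or [g]. *)
have noloop k : forall e, e \in W -> f e <> iter k p e.
  elim/ltn_ind: k => -[|[|k]] IH e eW.
  - by move=> fe; case: (fP e eW) => _; rewrite [f e]fe eqxx.
  - rewrite /= /p eW => /(congr1 f).
    case: (gP e eW) => geW gne _.
    case: (fP e eW) => _ _ ->; case: (fP _ geW) => _ _ -> ge.
    by rewrite -ge eqxx in gne.
  - rewrite iterS => fe.
    have [geW gne gge] := gP e eW; have [feW fne ffe] := fP e eW.
    have pge : p (g e) = f e by rewrite /p geW gge.
    move: fe; rewrite -pge => /pinj; rewrite -[k.+1]addn1 iterD /= => ge.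
    apply: (IH k _ (p e) (pW e eW)); first by lia.
    by rewrite -ge /p eW; case: (fP _ geW).
have nconn e : e \in W -> ~~ fconnect p e (f e).
  move=> eW; apply/negP => /iter_findex fe.
  exact: (noloop (findex p e (f e)) e eW).
pose rt := froot p.
have rtp e : rt (p e) = rt e.
  by apply/eqP; rewrite (root_connect psym) psym fconnect1.
have rtfp e : e \in W -> rt (f (p e)) = rt (f e).
  move=> eW; have [geW gne gge] := gP e eW.
  rewrite /p eW; case: (fP _ geW) => _ _ ->.
  by rewrite -[in LHS]rtp /p geW gge.
exists (fun e => enum_rank (rt e) < enum_rank (rt (f e))) => e eW.
have [geW gne gge] := gP e eW; have [feW fne ffe] := fP e eW.
have neq : (enum_rank (rt e) : nat) != enum_rank (rt (f e)).
  apply/negP => /eqP /val_inj /enum_rank_inj /eqP.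
  by rewrite (root_connect psym) (negbTE (nconn e eW)).
have rtg : rt (g e) = rt (f e).
  by rewrite -[RHS]rtfp // /p eW; case: (fP _ geW) => _ _ ->.
have rtfg : rt (f (g e)) = rt e by rewrite -[RHS]rtp /p eW.
by rewrite ffe rtg rtfg; split; rewrite -leqNgt ltn_neqAle eq_sym neq.
Qed.

Definition degree (V E : finType) (inc : V -> pred E) (F : {set E}) (v : V) :
  nat := #|[set e in F | inc v e]|.

(** The one feature of bipartite graphs on which log-concavity rests; a triangle does not have
    it. *)
Definition halvable (V E : finType) (inc : V -> pred E) : Prop :=
  forall W : {set E}, (forall v, ~~ odd (degree inc W v)) ->
  exists2 F : {set E}, F \subset W &
    forall v, (degree inc F v).*2 = degree inc W v.

Definition bip_inc (I J E : finType) (row : E -> I) (col : E -> J)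
    (v : I + J) : pred E :=
  match v with inl i => [pred e | row e == i] | inr j => [pred e | col e == j] end.

Lemma alternating_half (E : finType) (W P : {set E}) (f : E -> E)
    (chi : pred E) :
  (forall e, e \in W -> [/\ f e \in W, f (f e) = e & (f e \in P) = (e \in P)]) ->
  (forall e, e \in W -> chi (f e) = ~~ chi e) ->
  #|[set e in W | chi e] :&: P|.*2 = #|W :&: P|.
Proof.
move=> fP fchi.
set A := [set e in W | chi e] :&: P.
have AE e : (e \in A) = [&& e \in W, chi e & e \in P] by rewrite !inE andbA.
have finj : {in A &, injective f}.
  move=> x y; rewrite !AE => /and3P[xW _ _] /and3P[yW _ _] /(congr1 f).
  by case: (fP x xW) => _ -> _; case: (fP y yW) => _ -> _.
have fA : f @: A = (W :&: P) :\: A.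
  apply/setP => e; apply/imsetP/idP.
    case=> x; rewrite AE => /and3P[xW cx xP] ->.
    have [fxW _ fxP] := fP x xW.
    by rewrite in_setD AE in_setI fxW fxP xP (fchi x xW) cx.
  rewrite in_setD in_setI AE => /andP[nA /andP[eW eP]].
  have [feW ffe feP] := fP e eW; exists (f e) => //.
  by rewrite AE feW feP eP (fchi e eW); move: nA; rewrite eW eP !andbT.
have sA : A \subset W :&: P.
  by apply/subsetP => e; rewrite AE in_setI => /and3P[-> _ ->].
rewrite -addnn -{2}(card_in_imset finj) fA cardsD (setIidPr sA) subnKC //.
exact: subset_leq_card.
Qed.

(** Pair the edges at each row vertex by [f] and those at each column vertex by [g]. A colouring
    flipped by both splits the edges at every vertex evenly. *)
Lemma bip_halvable (I J E : finType) (row : E -> I) (col : E -> J) :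
  halvable (bip_inc row col).
Proof.
move=> W evenW.
have [f fP] := exists_pairing (key := row) (fun i => evenW (inl i)).
have [g gP] := exists_pairing (key := col) (fun j => evenW (inr j)).
have [|| chi chiP] := @alternating_colouring E W f g.
- by move=> e /fP[].
- by move=> e /gP[].
exists [set e in W | chi e].
  by apply/subsetP => e; rewrite inE => /andP[].
have degE F v : degree (bip_inc row col) F v =
                #|F :&: [set e | bip_inc row col v e]|.
  by rewrite /degree; apply: eq_card => e; rewrite !inE.
case=> [i|j]; rewrite !degE.
- apply: (alternating_half (f := f)) => e eW; last by case: (chiP e eW).
  by case: (fP e eW) => ? _ ? k; rewrite !inE /= k.
- apply: (alternating_half (f := g)) => e eW; last by case: (chiP e eW).
  by case: (gP e eW) => ? _ ? k; rewrite !inE /= k.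
Qed.

(** * Log-concavity of the number of subgraphs *)

Definition with_degree (V E : finType) (inc : V -> pred E) (W : {set E})
    (u : V -> nat) : {set {set E}} :=
  [set F : {set E} | F \subset W & [forall v, degree inc F v == u v]].

Lemma with_degreeP (V E : finType) (inc : V -> pred E) (W : {set E})
    (u : V -> nat) (F : {set E}) :
  reflect (F \subset W /\ forall v, degree inc F v = u v)
          (F \in with_degree inc W u).
Proof.
rewrite inE; apply: (iffP andP) => -[-> h]; split=> //.
  by move=> v; apply/eqP/(forallP h).
by apply/forallP => v; rewrite h.
Qed.

Lemma degreeU (V E : finType) (inc : V -> pred E) (F G : {set E}) v :
  [disjoint F & G] ->
  degree inc (F :|: G) v = degree inc F v + degree inc G v.
Proof.
move=> dFG; rewrite /degree -cardsUI.
rewrite (_ : _ :&: _ = set0) ?cards0 ?addn0.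
  by apply: eq_card => e; rewrite !inE andb_orl.
apply/setP => e; rewrite !inE; apply/negP => /andP[/andP[eF _] /andP[eG _]].
by have /disjointFr /(_ eF) := dFG; rewrite eG.
Qed.

Lemma degreeD (V E : finType) (inc : V -> pred E) (F G : {set E}) v :
  F \subset G -> degree inc G v = degree inc F v + degree inc (G :\: F) v.
Proof.
move=> sFG; rewrite -degreeU; last first.
  by rewrite -setI_eq0; apply/eqP/setP => e; rewrite !inE; case: (e \in F).
congr degree; apply/setP => e; rewrite !inE.
by case: (boolP (e \in F)) => //= /(subsetP sFG).
Qed.

(* A pair [(F, G)] with [F :&: G = T] and symmetric difference [U] is
   recovered from [K := F :\: G]. *)
Definition splits (V E : finType) (inc : V -> pred E) (T U : {set E})
    (u u' : V -> nat) : {set {set E}} :=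
  [set K : {set E} | K \subset U & [forall v,
     (degree inc T v + degree inc K v == u v) &&
     (degree inc T v + degree inc (U :\: K) v == u' v)]].

Lemma card_with_degree_pairs (V E : finType) (inc : V -> pred E) (W : {set E})
    (u u' : V -> nat) :
  #|with_degree inc W u| * #|with_degree inc W u'| =
  \sum_(q : {set E} * {set E} | [&& q.1 \subset W, q.2 \subset W &
          [disjoint q.1 & q.2]]) #|splits inc q.1 q.2 u u'|.
Proof.
rewrite -cardsX -sum1_card.
pose meet_diff (p : {set E} * {set E}) :=
  (p.1 :&: p.2, (p.1 :\: p.2) :|: (p.2 :\: p.1)).
rewrite (partition_big meet_diff (fun q => [&& q.1 \subset W, q.2 \subset W &
          [disjoint q.1 & q.2]])) /=; last first.
  case=> F G; rewrite inE /= => /andP[/with_degreeP[sF _] /with_degreeP[sG _]].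
  apply/and3P; split.
  - exact: subset_trans (subsetIl _ _) sF.
  - by rewrite subUset !(subset_trans (subsetDl _ _)).
  - rewrite -setI_eq0; apply/eqP/setP => e; rewrite !inE.
    by case: (e \in F); case: (e \in G).
apply: eq_bigr => -[T U] /= /and3P[sT sU dTU].
rewrite -(@card_in_imset _ _ (fun K => (T :|: K, T :|: (U :\: K)))); last first.
  move=> K K'; rewrite !inE => /andP[sK _] /andP[sK' _] [eKK' _].
  have TU e : e \in U -> e \notin T by move=> eU; rewrite (disjointFl dTU eU).
  apply/setP => e; move/setP/(_ e): eKK'; rewrite !inE.
  have := TU e; have := subsetP sK e; have := subsetP sK' e.
  by case: (e \in K); case: (e \in K'); case: (e \in T); case: (e \in U) => //=;
     do ?[move/(_ isT) => //]; move=> _; move/(_ isT) => //; move=> _ /(_ isT).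
rewrite sum1_card; apply: eq_card => -[F G].
apply/idP/imsetP; last first.
  case=> K; rewrite inE => /andP[sK /forallP dK] [-> ->].
  have dTK : [disjoint T & K] by rewrite (disjointWr sK).
  have dTUK : [disjoint T & U :\: K] by rewrite (disjointWr (subsetDl _ _)).
  rewrite unfold_in /= !inE /= !subUset sT (subset_trans sK sU).
  rewrite (subset_trans (subsetDl _ _) sU) /=.
  rewrite -andbA; apply/and3P; split.
  - by apply/forallP => v; rewrite degreeU //; case/andP: (dK v).
  - by apply/forallP => v; rewrite degreeU //; case/andP: (dK v).
  - rewrite /meet_diff /=; apply/eqP; congr (_, _); apply/setP => e; rewrite !inE.
      by case: (e \in T); case: (e \in K); case: (e \in U).
    have := subsetP sK e; have := disjointFr dTU (x := e).
    by case: (e \in T); case: (e \in K); case: (e \in U) => //= H1 H2;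
      [have := H1 isT | have := H1 isT | have := H2 isT].
rewrite unfold_in /= !inE /= => /andP[/andP[/andP[sF dF] /andP[sG dG]]].
case/eqP => TE UE.
have FE : F = T :|: (F :\: G).
  by rewrite -TE; apply/setP => e; rewrite !inE; case: (e \in F); case: (e \in G).
have UDE : U :\: (F :\: G) = G :\: F.
  by rewrite -UE; apply/setP => e; rewrite !inE; case: (e \in F); case: (e \in G).
have GE : G = T :|: (G :\: F).
  by rewrite -TE; apply/setP => e; rewrite !inE; case: (e \in F); case: (e \in G).
have dFG : [disjoint T & F :\: G].
  rewrite -setI_eq0 -TE; apply/eqP/setP => e; rewrite !inE.
  by case: (e \in F); case: (e \in G).
have dGF : [disjoint T & G :\: F].
  rewrite -setI_eq0 -TE; apply/eqP/setP => e; rewrite !inE.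
  by case: (e \in F); case: (e \in G).
exists (F :\: G); last by rewrite UDE -FE -GE.
rewrite inE -UE subsetUl UE UDE /=; apply/forallP => v.
by rewrite -!degreeU // -FE -GE (forallP dF) (forallP dG).
Qed.

(** Removing [T] turns [splits] into subgraphs of [U] with degrees lowered by those of [T]. If one
    exists, the truncated subtractions are exact and [U] has degrees [(b v).*2], so the hypothesis
    applies to [U]. *)
Lemma splits_le (V E : finType) (inc : V -> pred E) (T U : {set E})
    (u u' h : V -> nat) :
  (forall v, u v + u' v = (h v).*2) ->
  (forall a a' b : V -> nat, (forall v, a v + a' v = (b v).*2) ->
     (forall v, degree inc U v = (b v).*2) ->
     #|with_degree inc U a| <= #|with_degree inc U b|) ->
  #|splits inc T U u u'| <= #|splits inc T U h h|.
Proof.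
move=> uh IH.
have [->|/set0Pn[K0]] := eqVneq (splits inc T U u u') set0.
  by rewrite cards0.
rewrite inE => /andP[sK0 /forallP dK0].
pose dT v := degree inc T v; pose b v := h v - dT v.
have dU v : dT v <= u v /\ dT v <= u' v /\ degree inc U v = (b v).*2.
  have /andP[/eqP e1 /eqP e2] := dK0 v.
  have := degreeD inc v sK0; have := uh v; rewrite /b /dT; lia.
apply: leq_trans (_ : #|with_degree inc U (fun v => u v - dT v)| <= _).
  apply: subset_leq_card; apply/subsetP => K; rewrite inE => /andP[sK /forallP dK].
  apply/with_degreeP; split=> // v; have /andP[/eqP <- _] := dK v.
  by rewrite /dT; lia.
apply: leq_trans (IH _ (fun v => u' v - dT v) b _ _) _.
- by move=> v; have := dU v; have := uh v; rewrite /b; lia.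
- by move=> v; have := dU v; lia.
apply: subset_leq_card; apply/subsetP => K /with_degreeP[sK dK].
rewrite inE sK; apply/forallP => v; have := degreeD inc v sK.
have := dU v; have := uh v; have := dK v; rewrite /b /dT => e1 e2 e3 e4.
by apply/andP; split; apply/eqP; lia.
Qed.

(** Strong induction on [#|W|]. In the squares of the counts, the class [(set0, W)] contributes the
    count itself; every other class has [U] proper in [W], where the induction hypothesis compares
    the two sides. *)
Lemma with_degree_half_max (V E : finType) (inc : V -> pred E) :
  halvable inc -> forall (W : {set E}) (u u' h : V -> nat),
  (forall v, u v + u' v = (h v).*2) ->
  (forall v, degree inc W v = (h v).*2) ->
  #|with_degree inc W u| <= #|with_degree inc W h|.
Proof.
move=> halv W; have [N] := ubnP #|W|; elim: N W => // N IHN W ltWN u u' h uh dW.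
have compl_le a a' : (forall v, a v + a' v = (h v).*2) ->
    #|with_degree inc W a| <= #|with_degree inc W a'|.
  move=> aa'; rewrite -(@card_in_imset _ _ (fun F => W :\: F)); last first.
    move=> F G /with_degreeP[sF _] /with_degreeP[sG _] eFG.
    have DDK (K : {set E}) : K \subset W -> W :\: (W :\: K) = K.
      by move=> sK; rewrite setDDr setDv set0U (setIidPr sK).
    by rewrite -(DDK F sF) eFG DDK.
  apply: subset_leq_card; apply/subsetP => _ /imsetP[F /with_degreeP[sF dF] ->].
  apply/with_degreeP; split; first exact: subsetDl.
  by move=> v; have := degreeD inc v sF; have := aa' v; rewrite dF dW; lia.
have ueq : #|with_degree inc W u| = #|with_degree inc W u'|.
  apply/eqP; rewrite eqn_leq; apply/andP; split; apply: compl_le => // v.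
  by rewrite addnC.
(* Positivity matters: x = 1 and z = 0 would satisfy x^2 - x <= z^2 - z. *)
have hpos : 0 < #|with_degree inc W h|.
  have [|F sF dF] := halv W; first by move=> v; rewrite dW odd_double.
  apply/card_gt0P; exists F; apply/with_degreeP; split=> // v.
  by have := dF v; rewrite dW; lia.
have key (a a' : V -> nat) : (forall v, a v + a' v = (h v).*2) ->
    #|splits inc set0 W a a'| = #|with_degree inc W a|.
  move=> aa'; apply: eq_card => F; apply/idP/with_degreeP.
    rewrite inE => /andP[sF /forallP dF]; split=> // v.
    have /andP[/eqP <- _] := dF v.
    rewrite /degree (_ : [set e in set0 | _] = set0) ?cards0 //.
    by apply/setP => e; rewrite !inE.
  move=> [sF dF]; rewrite inE sF; apply/forallP => v.
  rewrite {1 3}/degree (_ : [set e in set0 | _] = set0) ?cards0; last first.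
    by apply/setP => e; rewrite !inE.
  have := degreeD inc v sF; have := aa' v; rewrite dW !add0n dF eqxx => e1 e2.
  by apply/eqP; lia.
have sq a a' : (forall v, a v + a' v = (h v).*2) ->
    #|with_degree inc W a| * #|with_degree inc W a'| =
    #|with_degree inc W a| +
    \sum_(q : {set E} * {set E} | [&& q.1 \subset W, q.2 \subset W &
          [disjoint q.1 & q.2]] && (q != (set0, W))) #|splits inc q.1 q.2 a a'|.
  move=> aa'; rewrite card_with_degree_pairs (bigD1 (set0, W)) /=; last first.
    by rewrite sub0set subxx -setI_eq0 set0I eqxx.
  by rewrite key.
have hh v : h v + h v = (h v).*2 by rewrite addnn.
have le_sums : \sum_(q : {set E} * {set E} | [&& q.1 \subset W, q.2 \subset W &
          [disjoint q.1 & q.2]] && (q != (set0, W))) #|splits inc q.1 q.2 u u'| <=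
  \sum_(q : {set E} * {set E} | [&& q.1 \subset W, q.2 \subset W &
          [disjoint q.1 & q.2]] && (q != (set0, W))) #|splits inc q.1 q.2 h h|.
  apply: leq_sum => -[T U] /= /andP[/and3P[sT sU dTU] neq].
  apply: splits_le => // a a' b ab dU; apply: (IHN U _ a a') => //.
  apply: leq_trans (_ : #|U| < #|W|) _; last by [].
  apply: proper_card; rewrite properEneq sU andbT.
  apply: contra neq => /eqP UW; rewrite -UW in sT *.
  by move: dTU; rewrite -setI_eq0 (setIidPl sT) => /eqP ->.
move: hpos (sq _ _ uh) (sq _ _ hh) le_sums; rewrite -ueq.
move: #|with_degree inc W u| #|with_degree inc W h| => x z z_gt0.
set S1 := (X in x * x = x + X); set S2 := (X in z * z = z + X) => ex ez S12.
by rewrite leqNgt; apply/negP => ltzx; nia.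
Qed.

Lemma with_degree_log_concave (V E : finType) (inc : V -> pred E)
    (W : {set E}) (u u' h : V -> nat) :
  halvable inc -> (forall v, u v + u' v = (h v).*2) ->
  #|with_degree inc W u| * #|with_degree inc W u'| <=
  #|with_degree inc W h| ^ 2.
Proof.
move=> halv uh; rewrite expnS expn1 !card_with_degree_pairs.
apply: leq_sum => -[T U] _; apply: splits_le => // a a' b ab dU.
exact: (with_degree_half_max halv (u' := a')).
Qed.

(** * Repeated edges *)

Definition grid_inc (I J T : finType) : I + J -> pred ((I * J) * T) :=
  bip_inc (fun e => e.1.1) (fun e => e.1.2).

(** N_k(u) of the overview with [k = #|T|]; elements of [T] label parallel edges. *)
Definition ngraphs (I J T : finType) (u : I + J -> nat) : nat :=
  #|with_degree (@grid_inc I J T) [set: (I * J) * T] u|.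

Lemma grid_inc_copy (I J T T' : finType) v p (t : T) (t' : T') :
  @grid_inc I J T v (p, t) = @grid_inc I J T' v (p, t').
Proof. by case: v. Qed.

Lemma degree_sum (I J T : finType) (F : {set (I * J) * T}) v :
  degree (@grid_inc I J T) F v =
  \sum_p \sum_t ((p, t) \in F) && (grid_inc v (p, t)).
Proof.
rewrite pair_bigA /= /degree -sum1_card big_mkcond /=.
by apply: eq_bigr => -[p t] _; rewrite inE; case: ifP.
Qed.

(** Sort the pairs by the degree vector of the first component; log-concavity bounds the number of
    pairs for each vector. *)
Lemma card_degree_pairs (V E : finType) (inc : V -> pred E) (h : V -> nat) :
  halvable inc ->
  #|[set p : {set E} * {set E} | [forall v,
       degree inc p.1 v + degree inc p.2 v == (h v).*2]]| <=
  #|E|.+1 ^ #|V| * #|with_degree inc [set: E] h| ^ 2.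
Proof.
move=> halv; rewrite -sum1_card.
pose d (p : {set E} * {set E}) : {ffun V -> 'I_#|E|.+1} :=
  [ffun v => inord (degree inc p.1 v)].
have dE p v : d p v = degree inc p.1 v :> nat.
  by rewrite ffunE inordK // ltnS max_card.
rewrite (partition_big d xpredT) //=.
apply: leq_trans (_ : \sum_(w : {ffun V -> 'I_#|E|.+1})
    #|with_degree inc [set: E] h| ^ 2 <= _); last first.
  by rewrite sum_nat_const card_ffun card_ord.
apply: leq_sum => w _.
(* The [minn] makes the two vectors sum to 2h even if [w] exceeds 2h somewhere, in which case the
   class is empty. *)
apply: leq_trans (with_degree_log_concave (u := fun v => minn (w v) (h v).*2)
  (u' := fun v => (h v).*2 - w v) _ halv _); last by move=> v; lia.
rewrite -cardsX sum1_card; apply: subset_leq_card; apply/subsetP => p.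
rewrite unfold_in /= !inE !subsetT /= => /andP[/forallP dp /eqP dw].
by apply/andP; split; apply/forallP => v; have := eqP (dp v);
  rewrite -dw dE => <-; apply/eqP; lia.
Qed.

(** The factor [bool] cuts a graph into two layers, a pair of graphs over [T] whose degrees add up
    to 2u. *)
Lemma ngraphs_double (I J T : finType) (u : I + J -> nat) :
  @ngraphs I J (T * bool)%type (fun v => (u v).*2) <=
  (#|I| * #|J| * #|T|).+1 ^ (#|I| + #|J|) * ngraphs T u ^ 2.
Proof.
have := card_degree_pairs u (@bip_halvable I J ((I * J) * T)%type
  (fun e => e.1.1) (fun e => e.1.2)).
rewrite card_sum !card_prod; apply: leq_trans.
pose layer b (F : {set (I * J) * (T * bool)}) := [set e | (e.1, (e.2, b)) \in F].
rewrite /ngraphs -(@card_in_imset _ _ (fun F => (layer true F, layer false F)));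
  last first.
  move=> F G _ _ [/setP e1 /setP e2]; apply/setP => -[p [t b]].
  by have := e1 (p, t); have := e2 (p, t); rewrite !inE /=; case: b.
apply: subset_leq_card; apply/subsetP => _ /imsetP[F /with_degreeP[_ dF] ->].
rewrite inE; apply/forallP => v; rewrite -dF !degree_sum -big_split /=.
apply/eqP/eq_bigr => p _; rewrite -big_split /=.
have -> : \sum_q ((p, q) \in F) && grid_inc v (p, q) =
    \sum_(t : T) \sum_b ((p, (t, b)) \in F) && grid_inc v (p, (t, b)).
  by rewrite pair_bigA; apply: eq_bigr => -[].
apply: eq_bigr => t _; rewrite big_bool !inE /=.
by rewrite !(@grid_inc_copy _ _ _ T _ _ (t, _) t).
Qed.

(** Label types of size 2^l, built so that each step is literally the doubling of
    [ngraphs_double]. *)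
Fixpoint cube (l : nat) : finType :=
  if l is l'.+1 then (cube l' * bool)%type else unit.

Lemma card_cube l : #|cube l| = 2 ^ l.
Proof.
by elim: l => [|l IH]; rewrite ?card_unit //= card_prod card_bool IH expnSr.
Qed.

(* The extra factor [(2 ^ (l + 2) * M) ^ c] on the left makes the induction
   on [l] go through. *)
Lemma ngraphs_cube (I J : finType) (u : I + J -> nat) l :
  0 < #|I| * #|J| ->
  ngraphs (cube l) (fun v => 2 ^ l * u v) *
    (2 ^ (l + 2) * (#|I| * #|J|)) ^ (#|I| + #|J|) <=
  (ngraphs unit u * (4 * (#|I| * #|J|)) ^ (#|I| + #|J|)) ^ (2 ^ l).
Proof.
set M := #|I| * #|J|; set c := #|I| + #|J| => M_gt0.
elim: l => [|l IH].
  rewrite expn1 leq_mul2r (_ : _ <= _) ?orbT //.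
  apply: subset_leq_card; apply/subsetP => F /with_degreeP[sF dF].
  by apply/with_degreeP; split=> // v; rewrite dF mul1n.
have -> : ngraphs (cube l.+1) (fun v => 2 ^ l.+1 * u v) =
    @ngraphs I J (cube l * bool)%type (fun v => (2 ^ l * u v).*2).
  apply: eq_card => F; rewrite !inE; congr (_ && _).
  by apply: eq_forallb => v; rewrite expnS -mulnA mul2n.
rewrite [2 ^ l.+1]expnSr expnM.
apply: leq_trans (leq_mul (ngraphs_double _ _) (leqnn _)) _.
apply: leq_trans (_ : _ <= (ngraphs (cube l) (fun v => 2 ^ l * u v) *
    (2 ^ (l + 2) * M) ^ c) ^ 2) _; last by rewrite leq_exp2r.
rewrite -/M -/c card_cube [leqRHS]expnMn -mulnA mulnCA leq_mul2l.
apply/orP; right.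
have c_gt0 : 0 < c by move: M_gt0; rewrite muln_gt0 addn_gt0 => /andP[->].
rewrite -expnMn -expnM [c * 2]mulnC expnM leq_exp2r //.
(* With k = 2^l the factors then balance exactly, (2Mk)(8Mk) = (4Mk)^2; hence the offset in
   [l + 2]. *)
have le1 : (M * 2 ^ l).+1 <= 2 * (M * 2 ^ l).
  have : 0 < M * 2 ^ l by rewrite muln_gt0 M_gt0 expn_gt0.
  by lia.
apply: leq_trans (leq_mul le1 (leqnn _)) _.
have -> : 2 ^ (l.+1 + 2) = 2 * (4 * 2 ^ l) by rewrite addSn expnS expnD mulnC; lia.
have -> : 2 ^ (l + 2) = 4 * 2 ^ l by rewrite expnD mulnC.
by move: (2 ^ l) => k; rewrite expnS expn1; nia.
Qed.

(** Choosing independently, at each position [p], which [A p] of the parallel edges to take yields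
    distinct subgraphs with degrees [u]. *)
Lemma prod_binomial_le_ngraphs (I J T : finType) (u : I + J -> nat)
    (A : I * J -> nat) :
  (forall i, \sum_j A (i, j) = u (inl i)) ->
  (forall j, \sum_i A (i, j) = u (inr j)) ->
  \prod_p 'C(#|T|, A p) <= ngraphs T u.
Proof.
move=> rowA colA.
pose fam (p : I * J) := [pred B : {set T} | #|B| == A p].
have -> : \prod_p 'C(#|T|, A p) = #|family fam|.
  rewrite card_family foldrE big_map big_enum /=; apply: eq_bigr => p _.
  by rewrite -card_draws; apply: eq_card => B; rewrite !inE.
pose graph (f : {ffun I * J -> {set T}}) : {set (I * J) * T} :=
  [set e | e.2 \in f e.1].
rewrite -(@card_in_imset _ _ graph); last first.
  move=> f g _ _ /setP efg; apply/ffunP => p; apply/setP => t.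
  by have := efg (p, t); rewrite !inE.
apply: subset_leq_card; apply/subsetP => _ /imsetP[f /familyP ff ->].
apply/with_degreeP; split=> [|v]; first exact: subsetT.
have fA p : #|f p| = A p by have := ff p; rewrite inE => /eqP.
have inner p : \sum_t ((p, t) \in graph f) && grid_inc v (p, t) =
    (match v with inl i => p.1 == i | inr j => p.2 == j end) * A p.
  rewrite -fA -sum1_card big_distrr /= [RHS]big_mkcond /=.
  apply: eq_bigr => t _; rewrite inE /= muln1.
  by case: (t \in f p) => //=; case: v.
rewrite degree_sum (eq_bigr _ (fun p _ => inner p)).
case: v {inner} => [i|j].
  rewrite -rowA (_ : \sum_p _ = \sum_a \sum_b (a == i) * A (a, b)); last first.
    by rewrite pair_bigA; apply: eq_bigr => -[].
  rewrite (bigD1 i) //= [X in _ + X]big1 ?addn0.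
    by apply: eq_bigr => b _; rewrite eqxx mul1n.
  by move=> a /negPf na; rewrite big1 // => b _; rewrite na.
rewrite -colA (_ : \sum_p _ = \sum_a \sum_b (b == j) * A (a, b)); last first.
  by rewrite pair_bigA; apply: eq_bigr => -[].
apply: eq_bigr => a _; rewrite (bigD1 j) //= [X in _ + X]big1 ?addn0.
  by rewrite eqxx mul1n.
by move=> b /negPf nb; rewrite nb.
Qed.

Local Open Scope ring_scope.

(** * Entropy *)

(** The Poisson weight a^b / b! is largest at b = a. *)
Lemma fact_exp_le (a b : nat) : (a`! * a ^ b <= b`! * a ^ a)%N.
Proof.
have up (d x : nat) : (x`! * x ^ d <= (x + d)`!)%N.
  elim: d => [|d IH]; first by rewrite expn0 muln1 addn0.
  rewrite addnS factS expnS mulnCA leq_mul //.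
  exact: leq_trans (leq_addr d x) (leqnSn _).
have down (d x : nat) : ((x + d)`! <= x`! * (x + d) ^ d)%N.
  elim: d => [|d IH]; first by rewrite addn0 expn0 muln1.
  rewrite addnS factS expnS mulnCA leq_mul //; apply: leq_trans IH _.
  by rewrite leq_mul //; case: d => // d; rewrite leq_exp2r.
have [le_ab|/ltnW le_ba] := leqP a b.
  have := up (b - a)%N a; rewrite subnKC // => h.
  rewrite -[X in (_ * a ^ X <= _)%N](subnKC le_ab) expnD mulnCA.
  by rewrite [leqRHS]mulnC leq_mul.
have := down (a - b)%N b; rewrite subnKC // => h.
rewrite -[X in (_ <= _ * a ^ X)%N](subnKC le_ba) expnD [leqRHS]mulnCA.
by rewrite [leqLHS]mulnC leq_mul.
Qed.

(** Expand k^k as (a + (k - a))^k: by [fact_exp_le], none of the k + 1 terms exceeds the one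
    containing a^a (k - a)^(k - a). *)
Lemma binomial_entropy_nat (k a : nat) : (a <= k)%N ->
  (k ^ k <= k.+1 * ('C(k, a) * (a ^ a * (k - a) ^ (k - a))))%N.
Proof.
move=> le_ak; set c := (k - a)%N.
rewrite -{1}(subnKC le_ak) -/c expnDn.
apply: leq_trans (_ : \sum_(i < k.+1) 'C(k, a) * (a ^ a * c ^ c) <= _)%N;
  last by rewrite sum_nat_const card_ord.
apply: leq_sum => b _; have le_bk : (b <= k)%N by rewrite -ltnS.
have f_gt0 : (0 < (b`! * (k - b)`!) * (a`! * c`!))%N by rewrite !muln_gt0 !fact_gt0.
rewrite -(leq_pmul2r f_gt0).
have -> : ('C(k, b) * (a ^ (k - b) * c ^ b) * (b`! * (k - b)`! * (a`! * c`!)) =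
           k`! * ((a`! * a ^ (k - b)) * (c`! * c ^ b)))%N.
  by rewrite -(bin_fact le_bk); ring.
have -> : ('C(k, a) * (a ^ a * c ^ c) * (b`! * (k - b)`! * (a`! * c`!)) =
           k`! * (((k - b)`! * a ^ a) * (b`! * c ^ c)))%N.
  by rewrite -(bin_fact le_ak) -/c; ring.
by rewrite leq_mul // leq_mul // fact_exp_le.
Qed.

(** Cross-entropy of Bernoulli(z) relative to Bernoulli(w), affine in [z]; at [w = z] it is the
    summand of [entropy]. *)
Definition cross_entropy (R : realType) (z w : R) : R :=
  z * ln (1 / w) + (1 - z) * ln (1 / (1 - w)).

(** The left side is k^k / (a^a (k - a)^(k - a)), where 0^0 = 1 matches 0 ln(1/0) = 0. *)
Lemma binomial_entropy (R : realType) (k a : nat) : (0 < k)%N -> (a <= k)%N ->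
  expR (k%:R * cross_entropy (a%:R / k%:R) (a%:R / k%:R)) <=
  (k.+1%:R * 'C(k, a)%:R : R).
Proof.
move=> k_gt0 le_ak.
have k0 : (k%:R : R) != 0 by rewrite pnatr_eq0 -lt0n.
have expE (b : nat) : expR (b%:R * ln (1 / (b%:R / k%:R : R))) * (b ^ b)%:R =
    (k ^ b)%:R :> R.
  have [->|b_gt0] := posnP b; first by rewrite mul0r expR0 mulr1.
  have bR : (0 : R) < b%:R by rewrite ltr0n.
  rewrite expRM_natl lnK ?posrE ?divr_gt0 ?ltr0n // natrX natrX -exprMn.
  by congr (_ ^+ _); field; rewrite k0 gt_eqF.
have cE : 1 - a%:R / k%:R = (k - a)%:R / k%:R :> R.
  by rewrite natrB // mulrBl divff.
have kE (b : nat) (x : R) : k%:R * (b%:R / k%:R * x) = b%:R * x.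
  by rewrite mulrA mulrCA divff // mulr1.
rewrite /cross_entropy cE mulrDr !kE.
have pos b : (0 : R) < (b ^ b)%:R.
  by rewrite ltr0n expn_gt0; case: b.
rewrite -(ler_pM2r (mulr_gt0 (pos a) (pos (k - a)%N))) expRD mulrACA !expE.
rewrite -!natrM ler_nat -expnD subnKC // -mulnA.
by apply: binomial_entropy_nat.
Qed.

(** This is ln x <= x - 1 at x = w/z, multiplied by z. The corrections [w - z] cancel once both
    outcomes are added. *)
Lemma gibbs_term (R : realType) (z w : R) : 0 <= z -> 0 <= w ->
  (w = 0 -> z = 0) -> z * ln (1 / z) <= z * ln (1 / w) + (w - z).
Proof.
move=> z0 w0 wz; have [->|zn0] := eqVneq z 0; first by rewrite !mul0r add0r subr0.
have z_gt0 : 0 < z by rewrite lt_neqAle eq_sym zn0.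
have w_gt0 : 0 < w.
  by rewrite lt_neqAle w0 andbT eq_sym; apply: contra_neq zn0.
have := @le_ln1Dx R (w / z - 1); rewrite addrCA subrr addr0 => /(_ _)/wrap[].
  by rewrite ltrBDl addrN divr_gt0.
rewrite !div1r ln_div ?posrE // !lnV ?posrE // => h.
have : z * (ln w - ln z) <= z * (w / z - 1) by rewrite ler_pM2l.
have -> : z * (w / z - 1) = w - z by field.
lra.
Qed.

(** The two implications exclude infinite cross-entropy, which the defaults 1/0 = 0 and ln 0 = 0
    would make finite. *)
Lemma gibbs (R : realType) (z w : R) : 0 <= z <= 1 -> 0 <= w <= 1 ->
  (w = 0 -> z = 0) -> (w = 1 -> z = 1) ->
  cross_entropy z z <= cross_entropy z w.
Proof.
move=> /andP[z0 z1] /andP[w0 w1] h0 h1.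
have g1 := gibbs_term z0 w0 h0.
have g2 : (1 - z) * ln (1 / (1 - z)) <=
          (1 - z) * ln (1 / (1 - w)) + ((1 - w) - (1 - z)).
  apply: gibbs_term; rewrite ?subr_ge0 // => h; rewrite h1; lra.
rewrite /cross_entropy; lra.
Qed.

Lemma cross_entropy_ge0 (R : realType) (z w : R) : 0 <= z <= 1 -> 0 <= w <= 1 ->
  0 <= cross_entropy z w.
Proof.
have ln_ge (x : R) : 0 <= x <= 1 -> 0 <= ln (1 / x).
  move=> /andP[x0 x1]; have [->|xn0] := eqVneq x 0.
    by rewrite div1r invr0 ln0.
  have x_gt0 : 0 < x by rewrite lt_neqAle eq_sym xn0.
  by apply: ln_ge0; rewrite ler_pdivlMr // mul1r.
move=> /andP[z0 z1] w01; have w01' : 0 <= 1 - w <= 1 by lra.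
by rewrite addr_ge0 // mulr_ge0 ?ln_ge // subr_ge0.
Qed.

Lemma cross_entropy_mix (R : realType) (t z x w : R) :
  cross_entropy ((1 - t) * z + t * x) w =
  (1 - t) * cross_entropy z w + t * cross_entropy x w.
Proof. by rewrite /cross_entropy; ring. Qed.

(** After Gibbs, the cross-entropy is affine in [z] with slope ln(1/w) - ln(1/(1-w)), at most
    ln(1/b) in absolute value. *)
Lemma entropy_near (R : realType) (z w b d : R) : 0 <= z <= 1 ->
  0 < b -> b <= w -> b <= 1 - w -> `|z - w| <= d ->
  cross_entropy z z <= cross_entropy w w + d * ln (1 / b).
Proof.
move=> z01 b0 bw bw' zw.
have g : cross_entropy z z <= cross_entropy z w.
  by apply: gibbs => //; lra.
apply: le_trans g _.
have -> : cross_entropy z w = cross_entropy w w +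
    (z - w) * (ln (1 / w) - ln (1 / (1 - w))).
  by rewrite /cross_entropy; ring.
rewrite lerD2l; apply: le_trans (ler_norm _) _; rewrite normrM.
apply: ler_pM => //.
have lnb (x : R) : b <= x -> x <= 1 -> 0 <= ln (1 / x) <= ln (1 / b).
  move=> bx x1; have x0 : 0 < x by lra.
  rewrite !div1r; apply/andP; split; first by rewrite ln_ge0 ?invf_ge1.
  by rewrite ler_ln ?posrE ?invr_gt0 // lef_pV2 ?posrE.
have := lnb w; have := lnb (1 - w) => /(_ bw')/(_ _)/wrap[]; first lra.
by move=> ? /(_ bw)/(_ _)/wrap[]; [lra | move=> ?; rewrite ler_norml; lra].
Qed.

(** * Lower bound on the number of 0-1 matrices *)

Lemma entropyE (R : realType) m n (X : 'M[R]_(m, n)) :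
  entropy X = \sum_p cross_entropy (X p.1 p.2) (X p.1 p.2).
Proof. by rewrite /entropy pair_bigA. Qed.

Lemma sum_ord_ltS (V : zmodType) m (f : 'I_m -> V) (i : 'I_m) :
  \sum_(a < m | (a < i.+1)%N) f a = \sum_(a < m | (a < i)%N) f a + f i.
Proof.
rewrite (bigD1 i) //= addrC; congr (_ + _); apply: eq_bigl => a.
by rewrite ltnS -val_eqE /= ltn_neqAle andbC.
Qed.

(* Second differences of the rounded-down cumulative sums have exact margins. *)
Lemma integer_rounding (R : realType) m n (Z : 'M[R]_(m, n))
    (r : 'I_m -> nat) (c : 'I_n -> nat) (k : nat) :
  (forall i, \sum_j Z i j = (r i)%:R) -> (forall j, \sum_i Z i j = (c j)%:R) ->
  exists A : 'I_m -> 'I_n -> int,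
    [/\ forall i, \sum_j A i j = (k * r i)%:Z,
        forall j, \sum_i A i j = (k * c j)%:Z &
        forall i j, `|(A i j)%:~R - k%:R * Z i j| <= 2].
Proof.
move=> rowZ colZ.
pose F a b := \sum_(i < m | (i < a)%N) \sum_(j < n | (j < b)%N) Z i j.
pose G a b : int := Num.floor (k%:R * F a b).
have FE a b : F a b = \sum_(j < n | (j < b)%N) \sum_(i < m | (i < a)%N) Z i j.
  by rewrite /F exchange_big.
have floor_int (x : int) : Num.floor (x%:~R : R) = x by apply: intrKfloor.
(* On the far boundary the scaled cumulative sums are integers, so rounding keeps them. *)
have Grow a : G a n = \sum_(i < m | (i < a)%N) (k * r i)%:Z.
  rewrite -[RHS]floor_int; congr Num.floor; rewrite rmorph_sum /F mulr_sumr.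
  apply: eq_bigr => i _; rewrite /= -pmulrn natrM -rowZ; congr (_ * _).
  by apply: eq_bigl => j; rewrite ltn_ord.
have Gcol b : G m b = \sum_(j < n | (j < b)%N) (k * c j)%:Z.
  rewrite -[RHS]floor_int; congr Num.floor; rewrite rmorph_sum FE mulr_sumr.
  apply: eq_bigr => j _; rewrite /= -pmulrn natrM -colZ; congr (_ * _).
  by apply: eq_bigl => i; rewrite ltn_ord.
have G0r a : G a 0%N = 0.
  by rewrite /G FE big_pred0 // mulr0 -[0]/(0%:~R) floor_int.
have G0l b : G 0%N b = 0.
  by rewrite /G /F big_pred0 // mulr0 -[0]/(0%:~R) floor_int.
exists (fun i j => G i.+1 j.+1 - G i.+1 j - (G i j.+1 - G i j)); split.
- move=> i; pose g b := G i.+1 b - G i b.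
  transitivity (\sum_(0 <= j < n) (g j.+1 - g j)).
    by rewrite big_mkord; apply: eq_bigr => j _; rewrite /g; ring.
  by rewrite telescope_sumr // /g !G0r subrr subr0 !Grow sum_ord_ltS addrC addKr.
- move=> j; pose g a := G a j.+1 - G a j.
  transitivity (\sum_(0 <= i < m) (g i.+1 - g i)).
    by rewrite big_mkord; apply: eq_bigr => i _; rewrite /g; ring.
  by rewrite telescope_sumr // /g !G0l subrr subr0 !Gcol sum_ord_ltS addrC addKr.
- move=> i j.
  have ZE : Z i j = F i.+1 j.+1 - F i.+1 j - (F i j.+1 - F i j).
    by rewrite /F !sum_ord_ltS; ring.
  (* Each floor drops less than 1 and two of the four enter with each sign, so the error stays below
     2. *)
  have Gb a b : (G a b)%:~R <= k%:R * F a b < (G a b)%:~R + 1.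
    have := floor_itv (k%:R * F a b); rewrite intrD; exact.
  have := Gb i.+1 j.+1; have := Gb i.+1 j; have := Gb i j.+1; have := Gb i j.
  rewrite ZE !rmorphB /= ler_norml !mulrBr; lra.
Qed.

Lemma pos_lower_bound (R : realType) (T : finType) (f : T -> R) :
  (forall t, 0 < f t) -> exists2 b, 0 < b & forall t, b <= f t.
Proof.
move=> f0; have s0 : 0 <= \sum_t (f t)^-1.
  by apply: sumr_ge0 => t _; rewrite invr_ge0 ltW.
(* The summand 1 keeps the bound positive when [T] is empty. *)
exists (1 + \sum_t (f t)^-1)^-1; first by rewrite invr_gt0; lra.
move=> t; rewrite -[leRHS]invrK lef_pV2 ?posrE ?invr_gt0 //; last by lra.
rewrite (bigD1 t) //=; have : 0 <= \sum_(i | i != t) (f i)^-1.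
  by apply: sumr_ge0 => i _; rewrite invr_ge0 ltW.
lra.
Qed.

Definition margins m n (r : 'I_m -> nat) (c : 'I_n -> nat) (v : 'I_m + 'I_n) :
  nat := match v with inl i => r i | inr j => c j end.

Lemma ngraphs_unit_le m n (r : 'I_m -> nat) (c : 'I_n -> nat) :
  (ngraphs unit (margins r c) <= #|Sigma01 r c|)%N.
Proof.
pose mat (F : {set ('I_m * 'I_n) * unit}) : 'M[bool]_(m, n) :=
  \matrix_(i, j) (((i, j), tt) \in F).
rewrite /ngraphs -(@card_in_imset _ _ mat); last first.
  move=> F G _ _ /matrixP eFG; apply/setP => -[[i j] []].
  by have := eFG i j; rewrite !mxE.
apply: subset_leq_card; apply/subsetP => _ /imsetP[F /with_degreeP[_ dF] ->].
have degE v : degree (@grid_inc 'I_m 'I_n unit) F v =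
    (\sum_i \sum_j (mat F i j && grid_inc v ((i, j), tt)))%N.
  rewrite degree_sum [RHS]pair_bigA /=; apply: eq_bigr => -[i j] _.
  by rewrite (big_pred1 tt) ?mxE // => -[].
rewrite inE; apply/andP; split; apply/forallP.
  move=> i; rewrite -[r i]/(margins r c (inl i)) -dF degE (bigD1 i) //=.
  rewrite [X in (_ + X)%N]big1 ?addn0 => [|a /negPf na].
    by apply/eqP/eq_bigr => j _; rewrite eqxx andbT.
  by rewrite big1 // => j _; rewrite na andbF.
move=> j; rewrite -[c j]/(margins r c (inr j)) -dF degE.
apply/eqP/eq_bigr => i _; rewrite (bigD1 j) //= [X in (_ + X)%N]big1 ?addn0.
  by rewrite eqxx andbT.
by move=> b /negPf nb; rewrite nb andbF.
Qed.

(** Shows that [l = 4 * C] is large enough for [k = 2 ^ l] to dominate [C * l.+1]. *)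
Lemma mul_le_exp2 (C : nat) : (C * (4 * C).+1 <= 2 ^ (4 * C))%N.
Proof.
case: C => // C.
have lt1 : (2 * C.+1 < 2 ^ (2 * C.+1))%N by apply: ltn_expl.
have -> : (4 * C.+1 = 2 * C.+1 + 2 * C.+1)%N by lia.
by rewrite expnD; apply: leq_trans (leq_mul lt1 lt1); nia.
Qed.

(** Split the entropy of the mixture by affinity of the cross-entropy: Gibbs bounds the [Z] part
    below, and the [X] part is nonnegative. *)
Lemma entropy_mix (R : realType) m n (X Z : 'M[R]_(m, n)) (t : R) :
  (forall i j, 0 <= Z i j <= 1) -> (forall i j, 0 < X i j < 1) -> 0 < t <= 1 ->
  (1 - t) * entropy Z <= entropy ((1 - t) *: Z + t *: X).
Proof.
move=> Z01 X01 t01; rewrite !entropyE mulr_sumr; apply: ler_sum => -[i j] _ /=.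
rewrite !mxE; set w := (1 - t) * Z i j + t * X i j.
have := Z01 i j; have := X01 i j => xij zij.
have w01 : 0 < w < 1.
  apply/andP; split; rewrite /w; first by nra.
  have : 0 <= (1 - t) * (1 - Z i j) by nra.
  have : 0 < t * (1 - X i j) by nra.
  nra.
rewrite {2}/w cross_entropy_mix.
have : cross_entropy (Z i j) (Z i j) <= cross_entropy (Z i j) w.
  by apply: gibbs => //; lra.
have : 0 <= cross_entropy (X i j) w by apply: cross_entropy_ge0; lra.
by nra.
Qed.

Lemma entropy_ge0 (R : realType) m n (X : 'M[R]_(m, n)) :
  (forall i j, 0 <= X i j <= 1) -> 0 <= entropy X.
Proof.
by move=> X01; rewrite entropyE sumr_ge0 // => -[i j] _; apply: cross_entropy_ge0.
Qed.

Lemma polytope_mix (R : realType) m n (r : 'I_m -> nat) (c : 'I_n -> nat)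
    (X Z : 'M[R]_(m, n)) (t : R) :
  polytope r c Z -> polytope r c X -> 0 <= t <= 1 ->
  polytope r c ((1 - t) *: Z + t *: X).
Proof.
move=> [rZ cZ Z01] [rX cX X01] t01; split=> [i|j|i j].
- rewrite (eq_bigr (fun j => (1 - t) * Z i j + t * X i j)); last first.
    by move=> j _; rewrite !mxE.
  by rewrite big_split /= -!mulr_sumr rZ rX; ring.
- rewrite (eq_bigr (fun i => (1 - t) * Z i j + t * X i j)); last first.
    by move=> i _; rewrite !mxE.
  by rewrite big_split /= -!mulr_sumr cZ cX; ring.
- rewrite !mxE; have := Z01 i j; have := X01 i j; nra.
Qed.

(** Round k Z to integers [A] and compare the product of binomials with exp(k H(Z)). For large k,
    rounding and the factors k + 1 together cost at most exp(k); k-th roots leave the - 1 in the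
    exponent. *)
Lemma interior_lower_bound (R : realType) m n (r : 'I_m -> nat)
    (c : 'I_n -> nat) (Z : 'M[R]_(m, n)) :
  (0 < m)%N -> (0 < n)%N -> polytope r c Z -> (forall i j, 0 < Z i j < 1) ->
  expR (entropy Z - 1) <=
  (#|Sigma01 r c| * (4 * (m * n)) ^ (m + n))%:R.
Proof.
move=> m0 n0 [rZ cZ _] Z01.
have [b b0 bZ] : exists2 b : R, 0 < b & forall i j, b <= Z i j /\ b <= 1 - Z i j.
  have [p|b b0 bP] := @pos_lower_bound R ('I_m * 'I_n)%type
      (fun p => Num.min (Z p.1 p.2) (1 - Z p.1 p.2)).
    by have := Z01 p.1 p.2; rewrite lt_min; lra.
  by exists b => // i j; have := bP (i, j); rewrite le_min /= => /andP.
have b12 : b <= 1 / 2.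
  by have := bZ (Ordinal m0) (Ordinal n0); lra.
set L := ln (1 / (b / 2)).
have L0 : 0 <= L.
  by apply: ln_ge0; rewrite div1r invf_ge1; lra.
set M : R := (m * n)%:R.
have M0 : 0 <= M by rewrite ler0n.
(* The term 4/b will keep the entries of A/k in [b/2, 1 - b/2]; the other term makes the total error
   M (2L + l + 1) at most k. *)
pose C := (Num.truncn (4 / b + M * (2 * L + 1))).+1.
have ltC : 4 / b + M * (2 * L + 1) < C%:R by apply: truncnS_gt.
have b4 : 0 < 4 / b by apply: divr_gt0.
have ML : 0 <= M * L by apply: mulr_ge0.
pose l := (4 * C)%N; pose k := (2 ^ l)%N.
have leCk : (C * l.+1 <= k)%N by apply: mul_le_exp2.
have leCkR : C%:R * l.+1%:R <= k%:R :> R by rewrite -natrM ler_nat.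
have l1 : 1 <= l.+1%:R :> R by rewrite ler1n.
have C0 : 0 <= C%:R :> R by rewrite ler0n.
have kb : 4 / b <= k%:R by nra.
have kM : M * (2 * L + l.+1%:R) <= k%:R.
  have : M * l.+1%:R + M * (2 * L) <= C%:R * l.+1%:R by nra.
  by lra.
have k0 : (0 < k)%N by rewrite expn_gt0.
have k0R : 0 < k%:R :> R by rewrite ltr0n.
have kb2 : 2 / k%:R <= b / 2.
  rewrite ler_pdivrMr //; have : 4 / b * b <= k%:R * b by rewrite ler_pM2r.
  by rewrite divfK ?gt_eqF //; lra.
have [A [rA cA nA]] := integer_rounding k rZ cZ.
have wA i j : `|Z i j - (A i j)%:~R / k%:R| <= 2 / k%:R.
  rewrite -(ler_pM2r k0R) divfK ?gt_eqF // -{2}[k%:R]gtr0_norm // -normrM.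
  by rewrite mulrBl divfK ?gt_eqF // distrC mulrC.
have wb i j : b / 2 <= (A i j)%:~R / k%:R /\ b / 2 <= 1 - (A i j)%:~R / k%:R.
  by have := wA i j; have := bZ i j; rewrite ler_norml; lra.
have A_ge0 i j : 0 <= A i j.
  have [+ _] := wb i j => h; rewrite -(ler0z R).
  by rewrite -(pmulr_lge0 _ (_ : 0 < k%:R^-1)) ?invr_gt0 //; lra.
pose a (p : 'I_m * 'I_n) := `|A p.1 p.2|%N.
have aE i j : ((a (i, j))%:R : R) = (A i j)%:~R.
  by rewrite /a /= natr_absz ger0_norm.
have a_le p : (a p <= k)%N.
  case: p => i j; rewrite -(ler_nat R) aE.
  have [_ h] := wb i j.
  have : (A i j)%:~R / k%:R <= 1 :> R by lra.
  by rewrite ler_pdivrMr // mul1r.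
have := @prod_binomial_le_ngraphs _ _ (cube l) (fun v => k * margins r c v)%N a.
move=> /(_ _ _)/wrap[|| le_prod].
- move=> i /=; apply/eqP; rewrite -eqz_nat -rA -[X in X == _]natz natr_sum.
  by apply/eqP/eq_bigr => j _; rewrite natz /a /= gez0_abs.
- move=> j /=; apply/eqP; rewrite -eqz_nat -cA -[X in X == _]natz natr_sum.
  by apply/eqP/eq_bigr => i _; rewrite natz /a /= gez0_abs.
set B := ((4 * (m * n)) ^ (m + n))%N.
have le_cube : (\prod_p 'C(k, a p) <= (#|Sigma01 r c| * B) ^ k)%N.
  rewrite card_cube in le_prod; apply: leq_trans le_prod _.
  have := @ngraphs_cube _ _ (margins r c) l; rewrite !card_ord muln_gt0 m0 n0.
  move=> /(_ isT) h; apply: leq_trans (leq_trans _ h) _.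
    by apply: leq_pmulr; rewrite expn_gt0 muln_gt0 expn_gt0 muln_gt0 m0 n0.
  by rewrite leq_exp2r // leq_mul2r ngraphs_unit_le orbT.
pose w (p : 'I_m * 'I_n) : R := (a p)%:R / k%:R.
have sum_w : entropy Z <= \sum_p cross_entropy (w p) (w p) + M * (2 / k%:R * L).
  have -> : M * (2 / k%:R * L) = \sum_(p : 'I_m * 'I_n) (2 / k%:R * L).
    by rewrite sumr_const card_prod !card_ord /M mulr_natl.
  rewrite entropyE -big_split /=; apply: ler_sum => -[i j] _ /=.
  have [w1 w2] := wb i j; rewrite /w aE.
  by apply: entropy_near => //; have := Z01 i j; lra.
have le_expprod : expR (k%:R * \sum_p cross_entropy (w p) (w p)) <=
    k.+1%:R ^+ (m * n) * (\prod_p 'C(k, a p))%:R.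
  have -> : k.+1%:R ^+ (m * n) = \prod_(p : 'I_m * 'I_n) (k.+1%:R : R).
    by rewrite prodr_const card_prod !card_ord.
  rewrite natr_prod -big_split mulr_sumr expR_sum /=; apply: ler_prod => p _.
  by rewrite expR_ge0 binomial_entropy.
have le_k : k.+1%:R ^+ (m * n) <= expR (M * l.+1%:R).
  rewrite /M expRM_natl lerXn2r ?nnegrE ?expR_ge0 ?ler0n //.
  rewrite -[l.+1%:R]mulr1 expRM_natl.
  apply: le_trans (_ : 2 ^+ l.+1 <= _).
    by rewrite -natrX ler_nat expnS -/k mul2n -addnn -addn1 leq_add2l.
  rewrite lerXn2r ?nnegrE ?expR_ge0 ?ler0n //.
  by apply: le_trans (expR_ge1Dx 1); lra.
have main : expR (entropy Z - 1) ^+ k <= (#|Sigma01 r c| * B)%:R ^+ k.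
  rewrite -expRM_natl; apply: le_trans (_ : expR (k%:R *
    \sum_p cross_entropy (w p) (w p) - M * l.+1%:R) <= _).
    rewrite ler_expR; have : k%:R * entropy Z <= k%:R *
      (\sum_p cross_entropy (w p) (w p) + M * (2 / k%:R * L)) by rewrite ler_pM2l.
    have -> : k%:R * (\sum_p cross_entropy (w p) (w p) + M * (2 / k%:R * L)) =
      k%:R * \sum_p cross_entropy (w p) (w p) + 2 * (M * L).
      by field; rewrite gt_eqF.
    by lra.
  rewrite expRD expRN -natrX; apply: le_trans (_ : _ <= (\prod_p 'C(k, a p))%:R) _;
    last by rewrite ler_nat.
  rewrite ler_pdivrMr ?expR_gt0 // [leRHS]mulrC; apply: le_trans le_expprod _.
  by rewrite ler_wpM2r.
by move: main; rewrite ler_pXn2r ?nnegrE ?expR_ge0 ?ler0n.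
Qed.

(** Entries of [Z] equal to 0 or 1 are removed by moving slightly towards the interior point [X]. *)
Lemma Sigma01_lower_bound (R : realType) m n (r : 'I_m -> nat)
    (c : 'I_n -> nat) (X Z : 'M[R]_(m, n)) :
  (0 < m)%N -> (0 < n)%N -> polytope r c Z ->
  polytope r c X -> (forall i j, 0 < X i j < 1) ->
  expR (entropy Z - 2) <= (#|Sigma01 r c| * (4 * (m * n)) ^ (m + n))%:R.
Proof.
move=> m0 n0 PZ PX X01; have [_ _ Z01] := PZ.
have H0 := entropy_ge0 Z01.
(* With this [t] the move costs at most t H(Z) < 1; the other 1 comes from
   [interior_lower_bound]. *)
pose t := (1 + entropy Z)^-1.
have t0 : 0 < t by rewrite invr_gt0; lra.
have tE : t * (1 + entropy Z) = 1 by rewrite mulVf // gt_eqF //; lra.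
have t1 : t <= 1 by nra.
have le_mix := entropy_mix Z01 X01 (_ : 0 < t <= 1).
have PW := polytope_mix PZ PX (_ : 0 <= t <= 1).
apply: le_trans (interior_lower_bound m0 n0 (PW _) _); [|lra|].
  rewrite ler_expR; have := le_mix ltac:(lra); nra.
move=> i j; rewrite !mxE; have := Z01 i j; have := X01 i j => x z.
have : 0 < t * X i j by nra.
have : 0 < t * (1 - X i j) by nra.
have : 0 <= (1 - t) * (1 - Z i j) by nra.
have : 0 <= (1 - t) * Z i j by nra.
lra.
Qed.

(** * Tail bounds *)

Definition bernoulli_prob (R : realType) m n (Z : 'M[R]_(m, n))
    (D : 'M[bool]_(m, n)) : R :=
  \prod_(p : 'I_m * 'I_n) (if D p.1 p.2 then Z p.1 p.2 else 1 - Z p.1 p.2).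

Lemma Sigma01_polytope (R : realType) m n (r : 'I_m -> nat) (c : 'I_n -> nat)
    (D : 'M[bool]_(m, n)) :
  D \in Sigma01 r c -> polytope r c (real_of_01 R D).
Proof.
rewrite inE => /andP[/forallP rD /forallP cD]; split=> [i|j|i j].
- rewrite -(eqP (rD i)) natr_sum; apply: eq_bigr => j _; by rewrite mxE.
- rewrite -(eqP (cD j)) natr_sum; apply: eq_bigr => i _; by rewrite mxE.
- by rewrite mxE; case: (D i j); rewrite ?lexx ?ler01.
Qed.

(** All factors lie in [0, 1], so raising each by at most [t] raises the product by at most [t] per
    factor. *)
Lemma prod_shift_le (R : realType) (T : Type) (a : T -> R) (t : R) (s : seq T) :
  (forall p, 0 <= a p <= 1) -> 0 <= t <= 1 ->
  \prod_(p <- s) (a p + t * (1 - a p)) <= \prod_(p <- s) a p + t * (size s)%:R.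
Proof.
move=> a01 t01; elim: s => [|p s IH]; first by rewrite !big_nil mulr0 addr0.
rewrite !big_cons /=; have := a01 p => ap.
have : 0 <= \prod_(q <- s) a q by apply: prodr_ge0 => q _; case/andP: (a01 q).
have : 0 <= \prod_(q <- s) (a q + t * (1 - a q)).
  by apply: prodr_ge0 => q _; have := a01 q; nra.
have : \prod_(q <- s) (a q + t * (1 - a q)) <= 1.
  by apply: prodr_ile1 => q _; have := a01 q; nra.
move: IH; rewrite -natr1; have : 0 <= (size s)%:R :> R by rewrite ler0n.
move: (\prod_(q <- s) _) (\prod_(q <- s) _) (size s)%:R => y x l l0 IH x1 x0 y0.
have ax : 0 <= a p * x by rewrite mulr_ge0 //; lra.
have : t * (1 - a p) * x <= t * 1 by rewrite -mulrA ler_wpM2l //; lra.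
have : a p * x <= a p * (y + t * l) by rewrite ler_wpM2l //; lra.
have : a p * (t * l) <= t * l by rewrite ler_piMl ?mulr_ge0 //; lra.
lra.
Qed.

(* Comparing [Z] with the mixtures [(1 - t) Z + t D] turns optimality of [Z]
   into this bound without differentiating, even if [Z] has entries 0 or 1. *)
Lemma bernoulli_prob_ge (R : realType) m n (r : 'I_m -> nat) (c : 'I_n -> nat)
    (Z : 'M[R]_(m, n)) (D : 'M[bool]_(m, n)) :
  is_max_entropy r c Z -> D \in Sigma01 r c ->
  expR (- entropy Z) <= bernoulli_prob Z D.
Proof.
move=> [PZ maxZ] DS; have [_ _ Z01] := PZ.
have PD := Sigma01_polytope R DS.
set s := index_enum ('I_m * 'I_n)%type.
pose a (p : 'I_m * 'I_n) := if D p.1 p.2 then Z p.1 p.2 else 1 - Z p.1 p.2.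
have a01 p : 0 <= a p <= 1.
  by rewrite /a; have := Z01 p.1 p.2; case: ifP => _ ?; lra.
apply/ler_addgt0Pl => e e0.
pose t := e / (e + (size s)%:R + 1).
have s0 : 0 <= (size s)%:R :> R by rewrite ler0n.
have t0 : 0 < t by apply: divr_gt0; lra.
have t1 : t < 1 by rewrite ltr_pdivrMr; lra.
have ts : t * (size s)%:R <= e.
  by rewrite mulrAC ler_pdivrMr ?ler_pM2l //; lra.
have t01 : 0 <= t <= 1 by lra.
have hW := maxZ _ (polytope_mix PZ PD t01).
set W := _ + _ in hW.
pose d (p : 'I_m * 'I_n) : R := (D p.1 p.2 : nat)%:R.
pose w p := (1 - t) * Z p.1 p.2 + t * d p.
have wE p : W p.1 p.2 = w p by rewrite !mxE.
have d01 p : 0 <= d p <= 1 by rewrite /d; case: (D _ _); rewrite ?lexx ?ler01.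
have parts_ge0 p : [/\ 0 <= (1 - t) * Z p.1 p.2, 0 <= (1 - t) * (1 - Z p.1 p.2),
    0 <= t * d p & 0 <= t * (1 - d p)].
  by have := d01 p; have := Z01 p.1 p.2; split; apply: mulr_ge0; lra.
have w01 p : 0 <= w p <= 1.
  by rewrite /w; have [] := parts_ge0 p; lra.
(* By Gibbs, [W] has entropy at least (1 - t) H(Z) plus t times this sum; by maximality, at most
   H(Z). Subtract and divide by t. *)
have cross_le : \sum_p cross_entropy (d p) (w p) <= entropy Z.
  have : (1 - t) * entropy Z + t * \sum_p cross_entropy (d p) (w p) <= entropy W.
    rewrite !entropyE !mulr_sumr -big_split /=; apply: ler_sum => p _.
    rewrite !wE {2}/w cross_entropy_mix lerD2r ler_wpM2l //; first by lra.
    have [z1 z2 d1 d2] := parts_ge0 p; have t1n0 : 1 - t != 0 by lra.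
    apply: gibbs => // wp; apply: (mulfI t1n0); rewrite /w in wp; lra.
  by move=> h; rewrite -(ler_pM2l t0); lra.
apply: le_trans (_ : \prod_p (a p + t * (1 - a p)) <= _); last first.
  have := prod_shift_le s a01 t01; rewrite /bernoulli_prob -/s => h.
  by apply: le_trans h _; rewrite addrC lerD2r.
apply: le_trans (_ : expR (- \sum_p cross_entropy (d p) (w p)) <= _).
  by rewrite ler_expR lerN2.
(* Each factor is the probability that a Bernoulli entry with mean [w p] agrees with [D], namely
   [a p + t * (1 - a p)]. *)
rewrite -sumrN expR_sum; apply: ler_prod => p _; rewrite expR_ge0 /=.
have expNln (x : R) : 0 < x -> expR (- ln x^-1) = x.
  by move=> x0; rewrite expRN lnK ?posrE ?invr_gt0 // invrK.
rewrite /cross_entropy /w /a /d; have := Z01 p.1 p.2.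
case: (D p.1 p.2) => /= zp.
  rewrite subrr mul0r addr0 !mul1r expNln; [lra | nra].
rewrite subr0 mul0r add0r !mul1r expNln; [lra | nra].
Qed.

(** Independence of the entries, expressed as distributivity. *)
Lemma sum_matrix_prod (R : realType) m n (G : 'I_m * 'I_n -> bool -> R) :
  \sum_(D : 'M[bool]_(m, n)) \prod_p G p (D p.1 p.2) =
  \prod_p (G p true + G p false).
Proof.
rewrite (eq_bigr (fun p => \sum_b G p b)); last by move=> p _; rewrite big_bool.
rewrite bigA_distr_bigA /=.
rewrite (reindex (fun f : {ffun 'I_m * 'I_n -> bool} =>
  \matrix_(i, j) f (i, j))) /=.
  by apply: eq_bigr => f _; apply: eq_bigr => -[i j] _; rewrite mxE.
exists (fun D : 'M[bool]_(m, n) => [ffun p => D p.1 p.2]).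
  by move=> f _; apply/ffunP => -[i j]; rewrite ffunE mxE.
by move=> D _; apply/matrixP => i j; rewrite mxE ffunE.
Qed.

(** From exp(-s) >= 1 - s, since (1 - s)(1 + s + 2s^2) = 1 + s^2 (1 - 2s) >= 1. Negative [s] serves
    the lower tail. *)
Lemma expR_quadratic_le (R : realType) (s : R) : s <= 1 / 2 ->
  expR s <= 1 + s + 2 * s ^+ 2.
Proof.
move=> s12; have := expR_ge1Dx (- s); rewrite expRN => h.
rewrite -[expR s]invrK invf_ple ?posrE ?invr_gt0 ?expR_gt0 //; last by nra.
apply: le_trans h; rewrite -[leLHS]mul1r ler_pdivrMr; last by nra.
have : 0 <= s ^+ 2 * (1 - 2 * s) by apply: mulr_ge0; [apply: sqr_ge0 | lra].
rewrite !expr2; lra.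
Qed.

(** The left side factors over the entries, and those in [S] satisfy 1 - z + z exp(s) <= 1 + z (s +
    2s^2) <= exp(z (s + 2s^2)). *)
Lemma bernoulli_mgf_le (R : realType) m n (S : {set 'I_m * 'I_n})
    (Z : 'M[R]_(m, n)) (s : R) :
  (forall i j, 0 <= Z i j <= 1) -> s <= 1 / 2 ->
  \sum_D bernoulli_prob Z D * expR (s * sigmaS S (real_of_01 R D)) <=
  expR ((s + 2 * s ^+ 2) * sigmaS S Z).
Proof.
move=> Z01 s12.
pose G (p : 'I_m * 'I_n) (b : bool) : R :=
  (if b then Z p.1 p.2 else 1 - Z p.1 p.2) *
  expR (s * (if p \in S then (b : nat)%:R else 0)).
rewrite (eq_bigr (fun D : 'M[bool]_(m, n) => \prod_p G p (D p.1 p.2))).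
  rewrite sum_matrix_prod /sigmaS [\sum_(p in S) _]big_mkcond mulr_sumr expR_sum /=.
  apply: ler_prod => p _; have := Z01 p.1 p.2 => zp.
  rewrite /G; case: (p \in S); rewrite ?mulr1 ?mulr0 ?expR0.
    have := expR_gt0 s; have := expR_quadratic_le s12.
    have := expR_ge1Dx ((s + 2 * s ^+ 2) * Z p.1 p.2).
    move: (expR s) (s ^+ 2) (expR _) => E s2 E' h1 h2 h3.
    apply/andP; split; first by nra.
    apply: le_trans h1.
    have : Z p.1 p.2 * E <= Z p.1 p.2 * (1 + s + 2 * s2) by rewrite ler_wpM2l //; lra.
    lra.
  by rewrite !mulr1; lra.
move=> D _; rewrite /G big_split /= /bernoulli_prob; congr (_ * _).
rewrite -expR_sum /sigmaS big_mkcond mulr_sumr /=; congr expR.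
by apply: eq_bigr => p _; rewrite mxE.
Qed.

(** Markov's inequality for exp(s sigma_S), each [D] in [B] having probability at least exp(-H(Z)).
    The sign of [s] selects the tail. *)
Lemma card_tail_le (R : realType) m n (r : 'I_m -> nat) (c : 'I_n -> nat)
    (S : {set 'I_m * 'I_n}) (Z : 'M[R]_(m, n)) (s a : R)
    (B : {set 'M[bool]_(m, n)}) :
  is_max_entropy r c Z -> s <= 1 / 2 -> B \subset Sigma01 r c ->
  (forall D, D \in B -> a <= s * sigmaS S (real_of_01 R D)) ->
  #|B|%:R <= expR (entropy Z + (s + 2 * s ^+ 2) * sigmaS S Z - a).
Proof.
move=> maxZ s12 sB aB; have [[_ _ Z01] _] := maxZ.
have prob_ge0 D : 0 <= bernoulli_prob Z D.
  by apply: prodr_ge0 => p _; have := Z01 p.1 p.2; case: ifP => _; lra.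
have : #|B|%:R * expR (a - entropy Z) <= expR ((s + 2 * s ^+ 2) * sigmaS S Z).
  apply: le_trans (bernoulli_mgf_le S Z01 s12).
  rewrite mulr_natl -sumr_const [leRHS](bigID (mem B)) /= -[leLHS]addr0.
  apply: lerD; last by apply: sumr_ge0 => D _; rewrite mulr_ge0 ?expR_ge0.
  apply: ler_sum => D DB; rewrite addrC expRD ler_pM ?expR_ge0 //.
    exact: bernoulli_prob_ge maxZ (subsetP sB _ DB).
  by rewrite ler_expR aB.
rewrite -ler_pdivlMr ?expR_gt0 // -expRN -expRD => h.
by apply: le_trans h _; rewrite ler_expR; lra.
Qed.

(** * Concentration: the tail bound against the size of Sigma(R,C) *)

Theorem theorem1p4 (R : realType) (kappa delta : R)
    (hkappa : 0 < kappa) (hdelta : 0 < delta < 1) :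
  exists q : R,
    forall (m n : nat) (r : 'I_m -> nat) (c : 'I_n -> nat)
           (Z : 'M[R]_(m, n)) (S : {set 'I_m * 'I_n}),
      (m <= n)%N ->
      q < m%:R ->
      (\sum_i r i = \sum_j c j)%N ->
      (forall i, (0 < r i < n)%N) ->
      (forall j, (0 < c j < m)%N) ->
      (exists X : 'M[R]_(m, n),
         polytope r c X /\ forall i j, 0 < X i j < 1) ->
      is_max_entropy r c Z ->
      delta * m%:R * n%:R <= sigmaS S Z ->
      let eps := delta * (ln (n%:R : R) / Num.sqrt (m%:R : R)) in
      eps <= 1 ->
      1 - 2 * n%:R `^ (- (kappa * n%:R)) <=
      unif_prob R (Sigma01 r c)
        (fun D => (1 - eps) * sigmaS S Z <= sigmaS S (real_of_01 R D)
                  <= (1 + eps) * sigmaS S Z).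
Proof.
have /andP[d0 d1] := hdelta.
have d3 : 0 < delta ^+ 3 by rewrite exprn_gt0.
(* Since ln n >= K, this gives kappa + 12 <= delta^3 ln n / 8; the 12 pays for the losses in the
   lower bound on |Sigma(R,C)|. *)
pose K := 8 * (kappa + 12) / delta ^+ 3.
exists (expR K) => m n r c Z S le_mn ltKm _ _ _ [X [PX X01]] maxZ.
set mu := sigmaS S Z => ge_mu eps eps1.
have m0R : 0 < (m%:R : R) by apply: lt_trans ltKm; apply: expR_gt0.
have m0 : (0 < m)%N by rewrite -(ltr0n R).
have n0 : (0 < n)%N := leq_trans m0 le_mn.
have n0R : 0 < (n%:R : R) by rewrite ltr0n.
have n1R : 1 <= (n%:R : R) by rewrite ler1n.
have [PZ _] := maxZ.
set L := ln (n%:R : R) in eps eps1 *.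
have leKL : K <= L.
  rewrite -[K]expRK ler_ln ?posrE ?expR_gt0 //.
  by apply/ltW/(lt_le_trans ltKm); rewrite ler_nat.
have K12 : kappa + 12 <= delta ^+ 3 * L / 8.
  have : delta ^+ 3 * K <= delta ^+ 3 * L by rewrite ler_pM2l.
  by rewrite /K [delta ^+ 3 * _]mulrC divfK ?gt_eqF //; lra.
have L1 : 1 <= L.
  have d31 : delta ^+ 3 <= 1 by rewrite exprn_ile1; lra.
  have L0 : 0 <= L by apply: ln_ge0.
  have : delta ^+ 3 * L <= 1 * L by rewrite ler_wpM2r.
  by lra.
have eps0 : 0 <= eps.
  by rewrite !mulr_ge0 ?invr_ge0 ?sqrtr_ge0 //; lra.
have le_eps : delta ^+ 3 * L * (L * n%:R) <= eps ^+ 2 * mu.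
  have -> : delta ^+ 3 * L * (L * n%:R) = eps ^+ 2 * (delta * m%:R * n%:R).
    rewrite /eps !exprMn exprVn sqr_sqrtr ?ler0n //; field.
    by rewrite gt_eqF.
  by rewrite ler_wpM2l ?sqr_ge0.
pose good := [set D in Sigma01 r c | (1 - eps) * mu <=
  sigmaS S (real_of_01 R D) <= (1 + eps) * mu].
pose hi := [set D in Sigma01 r c | (1 + eps) * mu < sigmaS S (real_of_01 R D)].
pose lo := [set D in Sigma01 r c | sigmaS S (real_of_01 R D) < (1 - eps) * mu].
(* The choice [s = eps / 4] minimizes 2s^2 - s eps, with value - eps^2 / 8; the lower tail uses its
   negative. *)
have le_hi : #|hi|%:R <= expR (entropy Z - eps ^+ 2 * mu / 8).
  have := @card_tail_le R m n r c S Z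
    (eps / 4) (eps / 4 * ((1 + eps) * mu)) hi maxZ.
  move=> /(_ _ _ _)/wrap[||D|h].
  - by lra.
  - by apply/subsetP => D /setIdP[].
  - by rewrite inE => /andP[_ /ltW hD]; rewrite ler_wpM2l //; lra.
  - by apply: le_trans h _; rewrite ler_expR -/mu; lra.
have le_lo : #|lo|%:R <= expR (entropy Z - eps ^+ 2 * mu / 8).
  have := @card_tail_le R m n r c S Z
    (- eps / 4) (- eps / 4 * ((1 - eps) * mu)) lo maxZ.
  move=> /(_ _ _ _)/wrap[||D|h].
  - by lra.
  - by apply/subsetP => D /setIdP[].
  - by rewrite inE => /andP[_ /ltW hD]; rewrite ler_wnM2l //; lra.
  - by apply: le_trans h _; rewrite ler_expR -/mu; lra.
have le_Sigma := Sigma01_lower_bound m0 n0 PZ PX X01.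
set N : R := #|Sigma01 r c|%:R.
(* Uses m <= n and 4n^2 <= exp(3 + 2L), raised to the power 2n. *)
have le_B : ((4 * (m * n)) ^ (m + n))%:R <= expR (n%:R * (6 + 4 * L)).
  apply: le_trans (_ : ((4 * (n * n)) ^ (n + n))%:R <= _).
    rewrite ler_nat; apply: leq_trans (_ : (4 * (n * n)) ^ (m + n) <= _)%N.
      by rewrite leq_exp2r ?addn_gt0 ?m0 // leq_mul2l /= leq_mul2r le_mn orbT.
    by rewrite leq_pexp2l ?leq_add2r // !muln_gt0 n0.
  rewrite natrX addnn -mul2n mulnC exprM.
  have -> : n%:R * (6 + 4 * L) = n%:R * (2 * (3 + (L + L))) by ring.
  rewrite expRM_natl -exprM mulnC exprM expRM_natl.
  rewrite !lerXn2r ?nnegrE ?exprn_ge0 ?ler0n ?expR_ge0 //.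
  rewrite expRD [expR (L + L)]expRD lnK ?posrE // !natrM ler_wpM2r ?mulr_ge0 //.
  by apply: le_trans (expR_ge1Dx 3); lra.
have N0 : 0 < N.
  rewrite /N ltr0n lt0n; apply/eqP => N0; move: le_Sigma.
  by rewrite N0 mul0n leNgt expR_gt0.
have le_N : expR (entropy Z - 2 - n%:R * (6 + 4 * L)) <= N.
  rewrite expRD expRN ler_pdivrMr ?expR_gt0 //.
  by apply: le_trans le_Sigma _; rewrite natrM ler_wpM2l ?ler0n.
have cover : N <= #|good|%:R + #|hi|%:R + #|lo|%:R.
  rewrite -!natrD ler_nat; apply: leq_trans (_ : #|good :|: hi :|: lo| <= _)%N.
    apply: subset_leq_card; apply/subsetP => D DS; rewrite !in_setU.
    case: (ltP (sigmaS S (real_of_01 R D)) ((1 - eps) * mu)) => h1.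
      by rewrite (_ : D \in lo) ?orbT //; apply/setIdP.
    case: (ltP ((1 + eps) * mu) (sigmaS S (real_of_01 R D))) => h2.
      by rewrite (_ : D \in hi) ?orbT //; apply/setIdP.
    by rewrite (_ : D \in good) //; apply/setIdP; rewrite h1 h2.
  apply: leq_trans (leq_card_setU _ _) _.
  by rewrite leq_add2r leq_card_setU.
(* The loss is 2 + n (6 + 4L) <= 12 n L, as 1 <= n <= n L; together with kappa n L it is at most
   eps^2 mu / 8. *)
have tail_le : expR (entropy Z - eps ^+ 2 * mu / 8) <=
    n%:R `^ (- (kappa * n%:R)) * N.
  apply: le_trans (_ : n%:R `^ (- (kappa * n%:R)) *
    expR (entropy Z - 2 - n%:R * (6 + 4 * L)) <= _); last first.
    by rewrite ler_wpM2l ?powR_ge0.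
  rewrite /powR gt_eqF // -/L -expRD ler_expR.
  have : (kappa + 12) * (L * n%:R) <= delta ^+ 3 * L / 8 * (L * n%:R).
    by rewrite ler_wpM2r // mulr_ge0 //; lra.
  have nL : n%:R <= L * n%:R by rewrite ler_peMl //; lra.
  by lra.
rewrite /unif_prob -/N -/good ler_pdivlMr // mulrBl mul1r.
by lra.
Qed.
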